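(* Let $\mathbb K$ be a field, let $A$ be a commutative associative $\mathbb K$-algebra with identity which is an integral domain, let $R$ be the quotient field of $A$, and let $W(A)=R\,\mathrm{Der}\,A$. Let $L$ be a nilpotent $\mathbb K$-subalgebra of the Lie algebra $W(A)$ of finite rank over $R$, and let $F=F(L)$ be the field of constants of $L$. Then the Lie algebra $FL$ is finite dimensional over $F$.
   Context: $\mathrm{Der}\,A$ denotes the Lie algebra of all $\mathbb K$-derivations of $A$; it is an $A$-module via $(aD)(x)=a\cdot D(x)$. Every derivation of $A$ extends uniquely to a derivation of the quotient field $R$, so $W(A)=R\,\mathrm{Der}\,A$ (the set of all $R$-linear combinations of such extended derivations) is a $\mathbb K$-Lie subalgebra of $\mathrm{Der}\,R$ and a vector space over $R$ (it is not in general a Lie algebra over $R$). Subalgebras of $W(A)$ are $\mathbb K$-subalgebras. For a subalgebra $L\subseteq W(A)$: $RL$ is the $R$-span of $L$ and the rank of $L$ over $R$ is $\mathrm{rk}_R L=\dim_R RL$; the field of constants of $L$ is $F(L)=\{r\in R \mid D(r)=0 \text{ for all } D\in L\}$, a subfield of $R$; $FL$ is the $F$-span of $L$ in $W(A)$, which is a Lie algebra over $F=F(L)$. *)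

(* Defs.v *)
From HB Require Import structures.
From mathcomp Require Import all_boot all_order all_algebra.
From mathcomp Require Import boolp classical_sets.

Set Implicit Arguments.
Unset Strict Implicit.
Unset Printing Implicit Defensive.

Import GRing.Theory.

Local Open Scope classical_set_scope.
Local Open Scope ring_scope.

#[short(type="idomAlgType")]
HB.structure Definition IdomAlgebra (K : fieldType) :=
  {A of GRing.Algebra K A & GRing.IntegralDomain A}.

Notation "x %:F" := (@FracField.tofrac _ x) : ring_scope.

(* The K-algebra structure of the quotient field of A is the one for which
   the embedding A -> {fraction A} is a morphism of K-algebras. *)
Section FractionAlgebra.
Variables (K : fieldType) (A : idomAlgType K).
Implicit Types (k l : K) (x y : {fraction A}).

Definition frac_scale k x : {fraction A} := (k%:A : A)%:F * x.

Fact frac_scaleA k l x : frac_scale k (frac_scale l x) = frac_scale (k * l) x.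
Proof.
by rewrite /frac_scale mulrA -rmorphM /= -scalerAl mul1r scalerA.
Qed.

Fact frac_scale1 : left_id 1 frac_scale.
Proof. by move=> x; rewrite /frac_scale scale1r rmorph1 mul1r. Qed.

Fact frac_scaleDr : right_distributive frac_scale +%R.
Proof. by move=> k x y; rewrite /frac_scale mulrDr. Qed.

Fact frac_scaleDl x : {morph frac_scale^~ x : k l / k + l}.
Proof. by move=> k l; rewrite /frac_scale scalerDl rmorphD mulrDl. Qed.

HB.instance Definition _ := GRing.Zmodule_isLmodule.Build K {fraction A}
  frac_scaleA frac_scale1 frac_scaleDr frac_scaleDl.

Fact frac_scaleAl k x y : k *: (x * y) = k *: x * y.
Proof. exact: mulrA. Qed.

HB.instance Definition _ :=
  GRing.Lmodule_isLalgebra.Build K {fraction A} frac_scaleAl.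

Fact frac_scaleAr k x y : k *: (x * y) = x * (k *: y).
Proof. exact: mulrCA. Qed.

HB.instance Definition _ :=
  GRing.Lalgebra_isAlgebra.Build K {fraction A} frac_scaleAr.

End FractionAlgebra.

Definition is_derivation (K : fieldType) (B : algType K) (D : B -> B) : Prop :=
  linear D /\ forall x y : B, D (x * y) = D x * y + x * D y.

(* Vector spaces of operators on a field R, over a subfield S of R that acts by
   (s D)(x) = s * D(x). Subfields and subspaces are represented as sets. *)
Section Spans.
Variable R : fieldType.
Implicit Types (S : set R) (X V : set (R -> R)).

Definition lincomb n (s : 'I_n -> R) (E : 'I_n -> R -> R) : R -> R :=
  fun x => \sum_(i < n) s i * E i x.

Definition lin_span S X : set (R -> R) :=
  [set D | exists n (s : 'I_n -> R) (E : 'I_n -> R -> R),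
    [/\ forall i, S (s i), forall i, X (E i) & D = lincomb s E]].

Definition is_basis S V n (E : 'I_n -> R -> R) : Prop :=
  [/\ forall i, V (E i),
      forall s : 'I_n -> R, (forall i, S (s i)) ->
        lincomb s E = (fun=> 0) -> forall i, s i = 0
    & forall D, V D ->
        exists2 s : 'I_n -> R, forall i, S (s i) & D = lincomb s E].

Definition has_dim S V n : Prop := exists E : 'I_n -> R -> R, is_basis S V E.

Definition finite_dim S V : Prop := exists n, has_dim S V n.

Definition lie_bracket (D E : R -> R) : R -> R := fun x => D (E x) - E (D x).

Definition has_rank (L : set (R -> R)) n : Prop :=
  has_dim setT (lin_span setT L) n.

Definition finite_rank (L : set (R -> R)) : Prop := exists n, has_rank L n.

Definition field_of_constants (L : set (R -> R)) : set R :=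
  [set r | forall D, L D -> D r = 0].

End Spans.

Section LieAlgebraW.
Variables (K : fieldType) (A : idomAlgType K).
Local Notation R := {fraction A}.

Definition extended_derivation : set (R -> R) :=
  [set E | is_derivation E /\
    exists2 D : A -> A, is_derivation D & forall a : A, E a%:F = (D a)%:F].

Definition W : set (R -> R) := lin_span setT extended_derivation.

Definition is_lie_subalgebra (L : set (R -> R)) : Prop :=
  [/\ L `<=` W,
      L (fun=> 0),
      forall (k : K) D E, L D -> L E -> L (fun x => k *: D x + E x)
    & forall D E, L D -> L E -> L (lie_bracket D E)].

Definition K_span (X : set (R -> R)) : set (R -> R) :=
  lin_span (range (fun k : K => k%:A : R)) X.

(* lower_central L n is the term L^(n+1) of the lower central series, with
   L^1 = L and L^(i+1) = [L, L^i]. *)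
Fixpoint lower_central (L : set (R -> R)) n : set (R -> R) :=
  if n is m.+1 then
    K_span [set lie_bracket D E | D in L & E in lower_central L m]
  else L.

Definition is_nilpotent (L : set (R -> R)) : Prop :=
  exists n, lower_central L n `<=` [set fun=> 0].

End LieAlgebraW.

(* Main.v *)
Require Import Defs.
From mathcomp Require Import all_boot all_order all_algebra.
From mathcomp Require Import boolp classical_sets.

(** Choose finitely many D_1, ..., D_n in L that span RL over R; this is
    possible because L has finite rank. Since every element of L is an R-linear
    combination of the D_i, an r in R killed by all the D_i is killed by L, that
    is, r lies in F. Each ad D_i is F-linear and maps L into L. Define
      V_0 = 0,  V_(m+1) = {E in RL | [D_i, E] in V_m for all i}.
    If the lower central series of L vanishes after N steps, then N successive
    brackets with the D_i kill L, so L is contained in V_N, and so is FL because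
    V_N is an F-subspace ([is_subspace_ad_killed]). It remains to see that every
    F-subspace of V_N is finite dimensional, by induction on N
    ([hereditarily_finite_dim_ad_killed]).

    The map E |-> ([D_i, E])_i sends V_(m+1) to the n-th power of V_m, and its
    kernel is C = {E in RL | [D_i, E] = 0 for all i}. So it suffices that C is
    small ([hereditarily_finite_dim_centralizer]). For a subspace U of C take a
    basis B_1, ..., B_k over R of the R-span of U consisting of elements of U,
    and write E in U as sum_k r_k B_k. Then
      0 = [D_i, E] = sum_k D_i(r_k) B_k + sum_k r_k [D_i, B_k]
        = sum_k D_i(r_k) B_k,
    so D_i(r_k) = 0 for all i and k: the r_k lie in F and the B_k already form
    an F-basis of U. *)

Set Implicit Arguments.
Unset Strict Implicit.
Unset Printing Implicit Defensive.

Import GRing.Theory.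

Local Open Scope classical_set_scope.
Local Open Scope ring_scope.

(** * Subspaces of operators over a set of scalars *)

Section LinearAlgebra.
Variable R : fieldType.
Implicit Types (S : set R) (U V X : set (R -> R)) (D : R -> R).

Definition is_subspace S U : Prop :=
  U (fun=> 0) /\
  forall s D E, S s -> U D -> U E -> U (fun x => s * D x + E x).

(** Asking for a basis of every subspace, and not only of [V], makes the
    property pass from an image and a kernel to the whole space with no
    dimension count, and lets it be inherited by subspaces for free. *)
Definition hereditarily_finite_dim S V : Prop :=
  forall U, is_subspace S U -> U `<=` V -> finite_dim S U.

Definition linear_over S (phi : (R -> R) -> R -> R) : Prop :=
  forall s D E, S s ->
    phi (fun x => s * D x + E x) = (fun x => s * phi D x + phi E x).

Definition cat_family T m n (f : 'I_m -> T) (g : 'I_n -> T) (i : 'I_(m + n)) :=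
  match split i with inl j => f j | inr j => g j end.

Lemma cat_family_lshift T m n (f : 'I_m -> T) (g : 'I_n -> T) j :
  cat_family f g (lshift n j) = f j.
Proof. by rewrite /cat_family -[lshift n j]/(unsplit (inl j)) unsplitK. Qed.

Lemma cat_family_rshift T m n (f : 'I_m -> T) (g : 'I_n -> T) j :
  cat_family f g (rshift m j) = g j.
Proof. by rewrite /cat_family -[rshift m j]/(unsplit (inr j)) unsplitK. Qed.

Lemma cat_familyP T (P : T -> Prop) m n (f : 'I_m -> T) (g : 'I_n -> T) :
  (forall i, P (f i)) -> (forall i, P (g i)) -> forall i, P (cat_family f g i).
Proof. by move=> Pf Pg i; rewrite /cat_family; case: (split i). Qed.

Lemma lincomb_cat m n (s : 'I_(m + n) -> R) (f : 'I_m -> R -> R) g :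
  lincomb s (cat_family f g) =
    fun x => lincomb (s \o @lshift m n) f x + lincomb (s \o @rshift m n) g x.
Proof.
apply: funext => x; rewrite /lincomb big_split_ord /=.
by congr (_ + _); apply: eq_bigr => i _;
  rewrite ?cat_family_lshift ?cat_family_rshift.
Qed.

Lemma lincomb_recl n (s : 'I_n.+1 -> R) E :
  lincomb s E = fun x =>
    s ord0 * E ord0 x + lincomb (s \o lift ord0) (E \o lift ord0) x.
Proof. by apply: funext => x; rewrite /lincomb big_ord_recl. Qed.

Lemma lincombN n (s : 'I_n -> R) E x :
  lincomb (fun i => - s i) E x = - lincomb s E x.
Proof. by rewrite /lincomb -sumrN; apply: eq_bigr => i _; rewrite mulNr. Qed.

Lemma subspace_add_lincomb S U n (s : 'I_n -> R) E D :
  is_subspace S U -> (forall i, S (s i)) -> (forall i, U (E i)) -> U D ->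
  U (fun x => lincomb s E x + D x).
Proof.
move=> [U0 Ucl]; elim: n s E => [|n IHn] s E Ss UE UD.
  suff -> : (fun x => lincomb s E x + D x) = D by [].
  by apply: funext => x; rewrite /lincomb big_ord0 add0r.
rewrite lincomb_recl.
have /(Ucl _ _ _ (Ss ord0) (UE ord0)) :=
  IHn (s \o lift ord0) (E \o lift ord0) (fun i => Ss _) (fun i => UE _) UD.
by congr (U _); apply: funext => x; rewrite addrA.
Qed.

Lemma subspace_lincomb S U n (s : 'I_n -> R) E :
  is_subspace S U -> (forall i, S (s i)) -> (forall i, U (E i)) ->
  U (lincomb s E).
Proof.
move=> sU Ss UE; have := subspace_add_lincomb sU Ss UE sU.1.
by congr (U _); apply: funext => x; rewrite addr0.
Qed.

Lemma sub_lin_span S X : S 1 -> X `<=` lin_span S X.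
Proof.
move=> S1 D XD; exists 1%N, (fun=> 1), (fun=> D); split=> //.
by apply: funext => x; rewrite /lincomb big_ord1 mul1r.
Qed.

Lemma is_subspace_lin_span S X :
  (forall r s, S r -> S s -> S (r * s)) -> is_subspace S (lin_span S X).
Proof.
move=> S_mul; split.
  exists 0%N, (fun=> 0), (fun=> fun=> 0); split=> [[]|[]|] //.
  by apply: funext => x; rewrite /lincomb big_ord0.
move=> r _ _ Sr [m [s [D [Ss XD ->]]]] [n [t [E [St XE ->]]]].
exists (m + n)%N, (cat_family (fun i => r * s i) t), (cat_family D E).
split; [apply: cat_familyP => // i; exact: S_mul | exact: cat_familyP |].
rewrite lincomb_cat; apply: funext => x; rewrite /lincomb mulr_sumr /=.
by congr (_ + _); apply: eq_bigr => i _;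
  rewrite ?cat_family_lshift ?cat_family_rshift ?mulrA.
Qed.

Lemma linear_over0 S phi : S 1 -> linear_over S phi -> phi (fun=> 0) = fun=> 0.
Proof.
move=> S1 phi_lin; have := phi_lin 1 (fun=> 0) (fun=> 0) S1.
have -> : (fun _ : R => 1 * 0 + 0 : R) = fun=> 0.
  by apply: funext => x; rewrite mulr0 addr0.
move=> eq_phi; apply: funext => x; move/(congr1 (@^~ x)): eq_phi => /=.
by rewrite mul1r -[LHS]addr0 => /addrI.
Qed.

Lemma linear_over_lincomb S phi n (s : 'I_n -> R) E :
  S 1 -> linear_over S phi -> (forall i, S (s i)) ->
  phi (lincomb s E) = lincomb s (phi \o E).
Proof.
move=> S1 phi_lin; elim: n s E => [|n IHn] s E Ss.
  have lc0 F : lincomb s F = fun=> 0.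
    by apply: funext => x; rewrite /lincomb big_ord0.
  by rewrite !lc0 (linear_over0 S1 phi_lin).
by rewrite !lincomb_recl phi_lin // IHn // => i; apply: Ss.
Qed.

(** The coefficient matrix of the [E i] has independent rows, so its height is
    its rank, which is at most its width. *)
Lemma free_size_le m n (E : 'I_m -> R -> R) (B : 'I_n -> R -> R)
    (c : 'I_m -> 'I_n -> R) :
  (forall i, E i = lincomb (c i) B) ->
  (forall s : 'I_m -> R, lincomb s E = (fun=> 0) -> forall i, s i = 0) ->
  (m <= n)%N.
Proof.
move=> Ec freeE; pose C := \matrix_(i, j) c i j.
suff /eqP <- : row_free C by exact: rank_leq_col.
apply: inj_row_free => v vC0; apply/rowP => i; rewrite mxE.
apply: (freeE (v 0)) => {i}; apply: funext => x.
transitivity (\sum_j (v *m C) 0 j * B j x).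
  rewrite /lincomb; under eq_bigr => i _ do rewrite Ec /lincomb mulr_sumr.
  rewrite exchange_big; apply: eq_bigr => j _; rewrite mxE mulr_suml.
  by apply: eq_bigr => i _; rewrite mxE mulrA.
by rewrite vC0 big1 // => j _; rewrite mxE mul0r.
Qed.

(** A free family of maximal length among those drawn from [X] is a basis. As
    [X] is an arbitrary set, this picks R-bases inside sets such as a Lie
    subalgebra or an F-subspace, which are not closed under the action of R. *)
Lemma finite_dim_sub_span n (B : 'I_n -> R -> R) X :
  (forall D, X D -> exists s, D = lincomb s B) -> finite_dim setT X.
Proof.
move=> spanB.
pose free_in m := `[< exists E : 'I_m -> R -> R, (forall i, X (E i)) /\
  forall s, lincomb s E = (fun=> 0) -> forall i, s i = 0 >].
have free0 : exists m, free_in m.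
  by exists 0%N; apply/asboolP; exists (fun=> fun=> 0); split=> [[]|? _ []].
have free_le m : free_in m -> (m <= n)%N.
  move=> /asboolP [E [XE freeE]].
  have [c Ec] := choice (fun i => spanB _ (XE i)).
  exact: free_size_le Ec freeE.
case: (ex_maxnP free0 free_le) => m /asboolP [E [XE freeE]] maxm.
exists m, E; split=> // [s _|D XD]; first exact: freeE.
(* By maximality, prepending D to E makes the family dependent; D then has a
   nonzero coefficient in the relation because E is free. *)
pose E' := fun i : 'I_m.+1 => oapp E D (unlift ord0 i).
have E'0 : E' ord0 = D by rewrite /E' unlift_none.
have E'S : E' \o lift ord0 = E by apply: funext => i; rewrite /E' /= liftK.
have XE' i : X (E' i) by rewrite /E'; case: (unlift _ i) => [j|] /=.
have [s s0E [i si_neq0]] : exists2 s : 'I_m.+1 -> R,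
    lincomb s E' = (fun=> 0) & exists i, s i != 0.
  apply: contrapT => noRel.
  suff /maxm : free_in m.+1 by rewrite ltnn.
  apply/asboolP; exists E'; split=> // s sE i; apply/eqP/negPn/negP => si.
  by apply: noRel; exists s => //; exists i.
have s0_neq0 : s ord0 != 0.
  apply/eqP => s00; move: s0E; rewrite lincomb_recl E'S => s0E.
  have sS0 : forall j, (s \o lift ord0) j = 0.
    apply: freeE; rewrite -s0E; apply: funext => x.
    by rewrite s00 mul0r add0r.
  move: si_neq0; case: (unliftP ord0 i) => [j|] ->; last by rewrite s00 eqxx.
  by rewrite [s _]sS0 eqxx.
exists (fun j => - (s ord0)^-1 * s (lift ord0 j)) => //.
apply: funext => x; move/(congr1 (@^~ x)): s0E.
rewrite lincomb_recl E'0 E'S /= => /eqP; rewrite addr_eq0 => /eqP sD.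
rewrite -[LHS](mulKf s0_neq0) sD mulrN -mulNr /lincomb mulr_sumr.
by apply: eq_bigr => j _; rewrite mulrA.
Qed.

(** * Finite dimensionality from kernels and images *)

Section Extension.
Variables (S : set R).
Hypotheses (S1 : S 1) (SN : forall s, S s -> S (- s)).

(** Lifts of a basis of the image of a subspace [U], followed by a basis of the
    kernel of [phi] on [U], form a basis of [U]. *)
Lemma hereditarily_finite_dim_ext phi V X :
  linear_over S phi -> (forall D, V D -> X (phi D)) ->
  hereditarily_finite_dim S X ->
  hereditarily_finite_dim S (V `&` [set D | phi D = fun=> 0]) ->
  hereditarily_finite_dim S V.
Proof.
move=> phi_lin phiV fdX fdK U sU UV.
have [m [B [imB freeB spanB]]] : finite_dim S (phi @` U).
  apply: fdX => [|_ [D UD <-]]; last exact/phiV/UV.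
  split=> [|s _ _ Ss [D UD <-] [E UE <-]].
    by exists (fun=> 0); [exact: sU.1 | exact: linear_over0 phi_lin].
  by exists (fun x => s * D x + E x); [exact: sU.2 | rewrite phi_lin].
have [n [C [kerC freeC spanC]]] :
    finite_dim S (U `&` [set D | phi D = fun=> 0]).
  apply: fdK => [|D [/UV]] //; split.
    by split; [exact: sU.1 | exact: linear_over0 phi_lin].
  move=> s D E Ss [UD phiD] [UE phiE]; split; first exact: sU.2.
  by rewrite /= phi_lin // phiD phiE; apply: funext => x; rewrite mulr0 addr0.
have [A UA] := choice (fun i => let: ex_intro2 D UD eD := imB i in
  ex_intro (fun D => U D /\ phi D = B i) D (conj UD eD)).
have phiA : phi \o A = B by apply: funext => i; exact: (UA i).2.
exists (m + n)%N, (cat_family A C); split.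
- by apply: cat_familyP => i; [exact: (UA i).1 | exact: (kerC i).1].
- move=> s Ss sAC.
  have Sl i : S ((s \o @lshift m n) i) by exact: Ss.
  have Sr i : S ((s \o @rshift m n) i) by exact: Ss.
  have sl0 : forall i, (s \o @lshift m n) i = 0.
    apply: freeB => //; rewrite -phiA.
    have := linear_over_lincomb (cat_family A C) S1 phi_lin Ss.
    rewrite sAC (linear_over0 S1 phi_lin).
    have -> : phi \o cat_family A C = cat_family (phi \o A) (fun=> fun=> 0).
      apply: funext => i; rewrite /cat_family /=.
      by case: (split i) => // j; exact: (kerC j).2.
    rewrite lincomb_cat => s0; apply: funext => x.
    have := congr1 (@^~ x) s0.
    by rewrite /= [X in _ + X]big1 ?addr0 // => j _; rewrite mulr0.
  have sr0 : forall i, (s \o @rshift m n) i = 0.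
    apply: freeC => //; rewrite -sAC lincomb_cat; apply: funext => x.
    by rewrite [X in X + _]big1 ?add0r // => j _; rewrite sl0 mul0r.
  move=> i; rewrite -(splitK i); case: (split i) => j /=.
    exact: sl0.
  exact: sr0.
- move=> D UD.
  (* D' is D minus the lift of phi D, so it lies in the kernel. *)
  have [b Sb phiD] := spanB _ (ex_intro2 _ _ D UD erefl).
  have SNb i : S (- b i) by exact: SN.
  pose D' := fun x => lincomb (fun i => - b i) A x + D x.
  have UD' : U D'.
    by apply: subspace_add_lincomb sU SNb _ UD => i; exact: (UA i).1.
  have phiD' : phi D' = fun=> 0.
    have -> : D' = fun x => 1 * lincomb (fun i => - b i) A x + D x.
      by apply: funext => x; rewrite mul1r.
    rewrite phi_lin // (linear_over_lincomb _ S1 phi_lin) // phiA phiD.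
    by apply: funext => x; rewrite mul1r lincombN addNr.
  have [c Sc D'c] := spanC _ (conj UD' phiD').
  exists (cat_family b c); first exact: cat_familyP.
  rewrite lincomb_cat; apply: funext => x.
  have -> : cat_family b c \o @lshift m n = b.
    by apply: funext => i; exact: cat_family_lshift.
  have -> : cat_family b c \o @rshift m n = c.
    by apply: funext => i; exact: cat_family_rshift.
  by rewrite -D'c /D' lincombN addrA subrr add0r.
Qed.

(** The kernels of the [phi i] are intersected one at a time, each step being
    an instance of the case of a single map. *)
Lemma hereditarily_finite_dim_joint_ext n (phi : 'I_n -> (R -> R) -> R -> R)
    V X :
  (forall i, linear_over S (phi i)) -> (forall i D, V D -> X (phi i D)) ->
  hereditarily_finite_dim S X ->
  hereditarily_finite_dim S (V `&` [set D | forall i, phi i D = fun=> 0]) ->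
  hereditarily_finite_dim S V.
Proof.
elim: n phi V => [|n IHn] phi V phi_lin phiV fdX fdK.
  by move=> U sU UV; apply: fdK => // D /UV VD; split=> // -[].
apply: (hereditarily_finite_dim_ext (phi_lin ord0) (phiV ord0) fdX).
apply: (IHn (phi \o lift ord0)) => //= [i D [/phiV]|] //.
move=> U sU UV; apply: fdK => // D /UV [[VD phi0D] phiSD]; split=> // i.
by case: (unliftP ord0 i) => [j|] -> //; exact: phiSD.
Qed.

End Extension.
End LinearAlgebra.

(** * Operators killed by iterated brackets *)

Section Derivations.
Variable R : fieldType.
Implicit Types (D : R -> R) (L : set (R -> R)).

Definition is_additive_derivation D : Prop :=
  (forall x y, D (x + y) = D x + D y) /\
  (forall x y, D (x * y) = D x * y + x * D y).

Lemma additive_derivation0 D : is_additive_derivation D -> D 0 = 0.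
Proof.
by move=> [DD _]; have := DD 0 0; rewrite addr0 -[LHS]addr0 => /addrI.
Qed.

Lemma additive_derivationN D x : is_additive_derivation D -> D (- x) = - D x.
Proof.
move=> dD; apply/eqP; rewrite -addr_eq0 -dD.1 addNr.
by rewrite additive_derivation0.
Qed.

Lemma additive_derivation1 D : is_additive_derivation D -> D 1 = 0.
Proof.
by move=> [_ DM]; have := DM 1 1; rewrite !mulr1 mul1r -[LHS]addr0 => /addrI.
Qed.

Lemma additive_derivation_sum D n (f : 'I_n -> R) :
  is_additive_derivation D -> D (\sum_i f i) = \sum_i D (f i).
Proof.
by move=> dD; apply: big_morph; [exact: dD.1 | exact: additive_derivation0].
Qed.

Lemma additive_derivation_lincomb n (s : 'I_n -> R) E :
  (forall i, is_additive_derivation (E i)) ->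
  is_additive_derivation (lincomb s E).
Proof.
move=> dE; split=> x y; rewrite /lincomb.
  by rewrite -big_split; apply: eq_bigr => i _; rewrite (dE i).1 mulrDr.
rewrite mulr_suml mulr_sumr -big_split; apply: eq_bigr => i _ /=.
by rewrite (dE i).2 mulrDr mulrA mulrCA.
Qed.

Section Constants.
Variables (n : nat) (L : set (R -> R)) (Ds : 'I_n -> R -> R).
Hypotheses (derL : forall D, L D -> is_additive_derivation D)
  (DsL : forall i, L (Ds i))
  (spanDs : forall D, L D -> exists s, D = lincomb s Ds).
Let F := field_of_constants L.

Lemma constants1 : F 1.
Proof. by move=> D /derL; exact: additive_derivation1. Qed.

Lemma constantsN s : F s -> F (- s).
Proof.
by move=> Fs D LD; rewrite additive_derivationN ?Fs ?oppr0 //; exact: derL.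
Qed.

Lemma constantsM r s : F r -> F s -> F (r * s).
Proof.
by move=> Fr Fs D LD; rewrite (derL LD).2 (Fr D LD) (Fs D LD) mul0r mulr0 addr0.
Qed.

(** By the Leibniz rule [D, s E] = D(s) E + s [D, E], and D(s) = 0 when s is a
    constant. *)
Lemma lie_bracket_linear_over D : L D -> linear_over F (lie_bracket D).
Proof.
move=> LD s E1 E2 Fs; apply: funext => x; have [DD DM] := derL LD.
rewrite /lie_bracket DD DM (Fs D LD) mul0r add0r mulrBr opprD -!addrA.
by congr (_ + _); rewrite addrCA.
Qed.

(** In a space of operators commuting with the [Ds i], coordinates with respect
    to an R-basis of commuting operators are killed by all the [Ds i], hence are
    constants; so an R-basis is already a basis over the constants. *)
Lemma hereditarily_finite_dim_centralizer :
  hereditarily_finite_dim F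
    (lin_span setT L `&` [set E | forall i, lie_bracket (Ds i) E = fun=> 0]).
Proof.
move=> U sU UC.
have [m [B [UB freeB spanB]]] : finite_dim setT U.
  apply: (@finite_dim_sub_span _ _ Ds) => D /UC [[k [s [E [_ LE ->]]]] _].
  have [c Ec] := choice (fun i => spanDs (LE i)).
  exists (fun j => \sum_i s i * c i j); apply: funext => x.
  rewrite /lincomb; under eq_bigr => i _ do rewrite Ec /lincomb mulr_sumr.
  rewrite exchange_big; apply: eq_bigr => j _; rewrite mulr_suml.
  by apply: eq_bigr => i _; rewrite mulrA.
exists m, B; split=> // [s _|E UE]; first exact: freeB.
have [r _ Er] := spanB _ UE; exists r => // j.
have Dsr i k : Ds i (r k) = 0.
  apply: (freeB (fun k => Ds i (r k))) => // {k}; apply: funext => x.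
  have /(congr1 (@^~ x)) := (UC _ UE).2 i.
  have dD := derL (DsL i).
  rewrite /lie_bracket Er /lincomb additive_derivation_sum // -sumrB.
  move=> /(etrans _); apply.
  apply: eq_bigr => k _; rewrite dD.2 -addrA -mulrBr.
  have /(congr1 (@^~ x)) := (UC _ (UB k)).2 i; rewrite /lie_bracket => ->.
  by rewrite mulr0 addr0.
move=> D /spanDs [c ->]; rewrite /lincomb big1 // => i _.
by rewrite Dsr mulr0.
Qed.

(** Only brackets with the finitely many [Ds i] are tested, so that a step of
    the recursion is controlled by finitely many maps. Membership in the R-span
    of [L] is required at every step, since that is what bounds the common
    kernel of these maps. *)
Fixpoint ad_killed m : set (R -> R) :=
  if m is k.+1 then
    [set E | lin_span setT L E /\ forall i, ad_killed k (lie_bracket (Ds i) E)]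
  else [set fun=> 0].

Lemma is_subspace_ad_killed m : is_subspace F (ad_killed m).
Proof.
elim: m => [|m [V0 Vcl]] /=.
  by split=> // s D E _ -> ->; apply: funext => x; rewrite mulr0 addr0.
have sRL : is_subspace setT (lin_span setT L) by exact: is_subspace_lin_span.
split=> [|s D E Fs [RLD VD] [RLE VE]].
  split=> [|i]; first exact: sRL.1.
  by rewrite (linear_over0 constants1) //; exact: lie_bracket_linear_over.
split=> [|i]; first exact: (sRL.2 s D E).
by rewrite lie_bracket_linear_over //; exact: Vcl.
Qed.

(** The maps [ad (Ds i)] send the operators of level [m.+1] to those of level
    [m], and [hereditarily_finite_dim_centralizer] bounds their common kernel. *)
Lemma hereditarily_finite_dim_ad_killed m :
  hereditarily_finite_dim F (ad_killed m).
Proof.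
elim: m => [|m IHm].
  move=> U [U0 _] U_0; exists 0%N, (fun=> fun=> 0).
  split=> [[]|s _ _ []|D /U_0 ->] //; exists (fun=> 0) => [[]|] //.
  by apply: funext => x; rewrite /lincomb big_ord0.
apply: (hereditarily_finite_dim_joint_ext constants1 constantsN
  (phi := fun i => lie_bracket (Ds i)) _ _ IHm).
- by move=> i; exact: lie_bracket_linear_over.
- by move=> i D [_ killD]; exact: killD.
move=> U sU UV; apply: hereditarily_finite_dim_centralizer => // D /UV.
by move=> [[RLD _] kD].
Qed.

End Constants.
End Derivations.

(** * Nilpotent subalgebras of W(A) *)

Lemma additive_derivation_W (K : fieldType) (A : idomAlgType K) D :
  @W K A D -> is_additive_derivation D.
Proof.
move=> [n [s [E [_ WE ->]]]]; apply: additive_derivation_lincomb => i.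
have [[linE mulE] _] := WE i; split=> // x y.
by have := linE 1 x y; rewrite !scale1r.
Qed.

Lemma lower_central_sub (K : fieldType) (A : idomAlgType K)
    (L : set ({fraction A} -> {fraction A})) n :
  is_lie_subalgebra L -> lower_central L n `<=` L.
Proof.
move=> [_ L0 Llin Lbr]; elim: n => [|n IHn] //= _ [m [s [E [Ks brE ->]]]].
apply: (@subspace_lincomb _ (range (fun k : K => k%:A : {fraction A}))) => //.
  split=> // _ D D' [k _ <-] LD LD'.
  have := Llin k _ _ LD LD'; congr (L _); apply: funext => x.
  by rewrite mulr_algl.
by move=> i; have [D LD [D' /IHn LD' <-]] := brE i; exact: Lbr.
Qed.

Theorem theorem1 (K : fieldType) (A : idomAlgType K)
    (L : set ({fraction A} -> {fraction A})) :
  is_lie_subalgebra L -> is_nilpotent L -> finite_rank L ->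
  finite_dim (field_of_constants L) (lin_span (field_of_constants L) L).
Proof.
move=> subL [N nilL] [n [B [_ _ spanB]]].
have derL D : L D -> is_additive_derivation D.
  by move=> LD; apply: additive_derivation_W; have [+ _ _ _] := subL; apply.
have RL_L : L `<=` lin_span setT L by exact: sub_lin_span.
have [m [Ds [DsL _ spanDs]]] : finite_dim setT L.
  by apply: (@finite_dim_sub_span _ _ B) => D /RL_L /spanB [s _ ->]; exists s.
have {}spanDs D : L D -> exists s, D = lincomb s Ds.
  by move=> /spanDs [s _ ->]; exists s.
(* Descending along the lower central series: its term of index N vanishes,
   and bracketing with Ds i moves one step down. *)
have lc_killed k j : (k + j)%N = N ->
    lower_central L k `<=` ad_killed L Ds j.
  elim: j k => [|j IHj] k; first by rewrite addn0 => ->.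
  rewrite addnS -addSn => /IHj IH E lcE; split.
    exact/RL_L/(lower_central_sub subL)/lcE.
  move=> i; apply: IH; apply: sub_lin_span; first by exists 1; rewrite ?scale1r.
  by exists (Ds i) => //; exists E.
apply: (hereditarily_finite_dim_ad_killed derL DsL spanDs (m := N)).
  by apply: is_subspace_lin_span => r s; exact: constantsM.
move=> _ [k [s [E [Fs LE ->]]]].
apply: subspace_lincomb Fs _; first exact: is_subspace_ad_killed.
by move=> i; apply: (lc_killed 0%N N).
Qed.
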